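(* Let $e\in\mathbb R^{n_x}$ be an error state. (i) If $$\|e\|^2_{A^\top\Gamma A}<\lambda\Big(\frac1\gamma-1\Big)-\mathrm{tr}(\Gamma K_W),$$ then the optimal action at $e$ is not to schedule a communication, i.e. $\arg\min_{a\in\{0,1\}}Q(e,a)=\{0\}$. (ii) If $$\|e\|^2_{A^\top\Gamma A}>\frac{\lambda}{\gamma(1-\gamma)}-\mathrm{tr}(\Gamma K_W),$$ then the optimal action at $e$ is to schedule a communication, i.e. $\arg\min_{a\in\{0,1\}}Q(e,a)=\{1\}$.
   Context: Let $A\in\mathbb R^{n_x\times n_x}$, $B\in\mathbb R^{n_x\times n_u}$, $Q_0\succeq 0$ (state weight), $R\succ 0$ (control weight), $\gamma\in(0,1)$, $\lambda>0$, with $(A,B)$ controllable and $(A,Q_0^{1/2})$ observable. Let $P\succeq 0$ be the unique positive semidefinite solution of $P=\gamma A^\top P A-\gamma^2A^\top PB\hat R^{-1}B^\top PA+Q_0$, where $\hat R:=R+\gamma B^\top PB$, and set $\Gamma:=\gamma^2A^\top PB\hat R^{-1}B^\top PA\succeq 0$. For a symmetric matrix $M\succeq0$, $\|z\|_M^2:=z^\top Mz$. Let $W_0,W_1,\dots$ be i.i.d. random vectors in $\mathbb R^{n_x}$ with zero mean and finite covariance $K_W$ (not necessarily Gaussian). Scheduling Markov decision process: state $e\in\mathbb R^{n_x}$ (the controller's estimation error), action $a\in\{0,1\}$ ($a=1$: schedule a communication; $a=0$: do not schedule), transition $e_{k+1}=(1-a_k)(Ae_k+W_k)$, running cost $\|e\|_\Gamma^2+\lambda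 a$, discount factor $\gamma$. A scheduling policy $\mu_s$ chooses $a_k$ causally from the information available at time $k$. Let $Q^{\mu_s}(e,a)=\mathbb E\big[\sum_{k=0}^\infty\gamma^k(\|e_k\|_\Gamma^2+\lambda a_k)\mid\mu_s,\ e_0=e,\ a_0=a\big]$ and let $Q(e,a)=\inf_{\mu_s}Q^{\mu_s}(e,a)$ be the optimal state-action value function, with $V(e)=\min_{a\in\{0,1\}}Q(e,a)$. These satisfy the Bellman equations $$Q(e,0)=\|e\|_\Gamma^2+\gamma\,\mathbb E[V(Ae+w)],\qquad Q(e,1)=\|e\|_\Gamma^2+\lambda+\gamma V(0),$$ where $w$ is distributed as $W_0$. The optimal action at $e$ is the minimizer of $Q(e,\cdot)$ over $\{0,1\}$. (The paper denotes the state weight by $Q$; it is written $Q_0$ here to distinguish it from the function $Q(e,a)$.) *)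

(* Defs.v *)
From HB Require Import structures.
From mathcomp Require Import all_boot all_order all_algebra.
From mathcomp Require Import finmap.
From mathcomp Require Import all_classical all_reals all_analysis.

Set Implicit Arguments.
Unset Strict Implicit.
Unset Printing Implicit Defensive.

Import Order.TTheory GRing.Theory Num.Theory.
Import numFieldNormedType.Exports.

Local Open Scope classical_set_scope.
Local Open Scope ring_scope.

Section LinearAlgebra.
Context {R : realType}.

Definition normsq n (M : 'M[R]_n) (z : 'cV[R]_n) : R := (z^T *m M *m z) 0 0.

Definition psd n (M : 'M[R]_n) : Prop :=
  M^T = M /\ forall z : 'cV[R]_n, 0 <= normsq M z.

Definition pd n (M : 'M[R]_n) : Prop :=
  M^T = M /\ forall z : 'cV[R]_n, z != 0 -> 0 < normsq M z.

(* S = M^(1/2); over a realType such an S exists and is unique when M is psd. *)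
Definition is_psd_sqrt n (S M : 'M[R]_n) : Prop := psd S /\ S *m S = M.

(* The matrix [B, AB, ..., A^(n-1) B] has full rank. *)
Definition controllable n m (A : 'M[R]_n) (B : 'M[R]_(n, m)) : Prop :=
  \rank (\mxrow_(k < n) (A ^+ k *m B)) = n.

(* The stacked matrix [C; CA; ...; CA^(n-1)] has full rank. *)
Definition observable n p (A : 'M[R]_n) (C : 'M[R]_(p, n)) : Prop :=
  \rank (\mxcol_(k < n) (C *m A ^+ k)) = n.

Section Riccati.
Context {n m : nat}.
Variables (A : 'M[R]_n) (B : 'M[R]_(n, m)) (Ru : 'M[R]_m) (gamma : R).

Definition Rhat (P : 'M[R]_n) : 'M[R]_m := Ru + gamma *: (B^T *m P *m B).

Definition Gamma_of (P : 'M[R]_n) : 'M[R]_n :=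
  gamma ^+ 2 *: (A^T *m P *m B *m invmx (Rhat P) *m B^T *m P *m A).

Definition riccati (Q0 P : 'M[R]_n) : Prop :=
  P = gamma *: (A^T *m P *m A) - Gamma_of P + Q0.

End Riccati.
End LinearAlgebra.

(* Column vectors carry the sigma-algebra generated by their coordinates; over
   a realType this is the Borel sigma-algebra of R^n. *)
Section measurable_cV.
Context {d : measure_display} {T : measurableType d} {n : nat}.

Let coords : 'I_n -> 'cV[T]_n -> T := fun i z => z i ord0.

Let cV_set0 : g_sigma_preimage coords set0.
Proof. exact: sigma_algebra0. Qed.

Let cV_setC A : g_sigma_preimage coords A -> g_sigma_preimage coords (~` A).
Proof. exact: sigma_algebraC. Qed.

Let cV_bigcup (F : (set 'cV[T]_n)^nat) :
  (forall i, g_sigma_preimage coords (F i)) ->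
  g_sigma_preimage coords (\bigcup_i (F i)).
Proof. exact: sigma_algebra_bigcup. Qed.

HB.instance Definition _ := @isMeasurable.Build (measure_tuple_display d)
  'cV[T]_n (g_sigma_preimage coords) cV_set0 cV_setC cV_bigcup.

End measurable_cV.

Section RandomVectors.
Context {R : realType} {d : measure_display} {Omega : measurableType d}.
Variable Pr : probability Omega R.

Definition mutually_independent d' (T : measurableType d')
    (X : nat -> {RV Pr >-> T}) : Prop :=
  forall (J : {fset nat}) (S : nat -> set T),
    (forall k, measurable (S k)) ->
    Pr (\bigcap_(k in [set` J]) (X k @^-1` S k)) =
    (\prod_(k <- J) Pr (X k @^-1` S k))%E.

Definition identically_distributed d' (T : measurableType d')
    (X : nat -> {RV Pr >-> T}) : Prop :=
  forall k (S : set T), measurable S ->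
    distribution Pr (X k) S = distribution Pr (X 0%N) S.

Definition coord n (X : Omega -> 'cV[R]_n) (i : 'I_n) : Omega -> R :=
  fun omega => X omega i ord0.

Definition zero_mean n (X : Omega -> 'cV[R]_n) : Prop :=
  forall i, coord X i \in Lfun Pr 1 /\ ('E_Pr[coord X i] = 0)%E.

Definition finite_covariance n (X : Omega -> 'cV[R]_n) : Prop :=
  forall i, coord X i \in Lfun Pr 2%:E.

Definition covariance_mx n (X : Omega -> 'cV[R]_n) : 'M[R]_n :=
  \matrix_(i, j) fine (covariance Pr (coord X i) (coord X j)).

End RandomVectors.

Section Scheduling.
Context {R : realType} {n : nat}.

(* Information available at time k: the states e_k, ..., e_0 and the past
   actions a_(k-1), ..., a_0, both most recent first. *)
Definition history (k : nat) : Type := (k.+1.-tuple 'cV[R]_n * k.-tuple bool)%type.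

Definition current k (h : history k) : 'cV[R]_n := thead h.1.

(* true = schedule a communication, false = do not schedule. *)
Definition policy : Type := forall k, {mfun history k >-> bool}.

Variables (A Gamma : 'M[R]_n) (lambda gamma : R).

Definition transition (e : 'cV[R]_n) (a : bool) (w : 'cV[R]_n) : 'cV[R]_n :=
  (1 - a%:R) *: (A *m e + w).

Definition stage_cost (e : 'cV[R]_n) (a : bool) : R :=
  normsq Gamma e + lambda * a%:R.

(* The initial action is prescribed to be a0; mu is followed from time 1 on. *)
Definition action (mu : policy) (a0 : bool) k : history k -> bool :=
  if k is 0 then fun=> a0 else mu k.

Fixpoint run (mu : policy) (e0 : 'cV[R]_n) (a0 : bool) (w : nat -> 'cV[R]_n)
    (k : nat) : history k :=
  if k is j.+1 then
    let h := run mu e0 a0 w j in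
    let a := action mu a0 h in
    ([tuple of transition (current h) a (w j) :: h.1], [tuple of a :: h.2])
  else ([tuple e0], [tuple]).

Definition run_cost (mu : policy) (e0 : 'cV[R]_n) (a0 : bool)
    (w : nat -> 'cV[R]_n) (k : nat) : R :=
  let h := run mu e0 a0 w k in stage_cost (current h) (action mu a0 h).

Context {d : measure_display} {Omega : measurableType d}.
Variables (Pr : probability Omega R) (W : nat -> {RV Pr >-> 'cV[R]_n}).

Definition Qpolicy (mu : policy) (e : 'cV[R]_n) (a : bool) : \bar R :=
  (\int[Pr]_omega
     \sum_(0 <= k <oo)
       (gamma ^+ k * run_cost mu e a (fun j => W j omega) k)%:E)%E.

Definition Qopt (e : 'cV[R]_n) (a : bool) : \bar R :=
  ereal_inf [set Qpolicy mu e a | mu in [set: policy]].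

End Scheduling.

Definition argmin (R : realType) (T : Type) (f : T -> \bar R) : set T :=
  [set x | forall y, (f x <= f y)%E].

(* Main.v *)
Require Import Defs.
From HB Require Import structures.
From mathcomp Require Import all_boot all_order all_algebra.
From mathcomp Require Import finmap ring lra.
From mathcomp Require Import all_classical all_reals all_analysis.
From mathcomp Require Import measurable_realfun.

(** Scheduling at time 0 resets the state to 0. Two comparisons of policies then
    settle both claims, without the Bellman equation.

    (i) Given a policy [mu] started with a communication, wait once, schedule at
    time 1, and then replay [mu] one step late. The noise being i.i.d., the
    replayed costs have the same law as those of [mu], now discounted by one
    more factor gamma, so the saving is at least
    lambda - gamma * (|A e|^2_Gamma + tr(Gamma KW) + lambda), which is positive.

    (ii) Not scheduling at time 0 costs at least
    |e|^2_Gamma + gamma * (|A e|^2_Gamma + tr(Gamma KW)) in the first two steps,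
    whereas always scheduling costs |e|^2_Gamma + lambda / (1 - gamma). *)

Set Implicit Arguments.
Unset Strict Implicit.
Unset Printing Implicit Defensive.

Import Order.TTheory GRing.Theory Num.Theory.
Import numFieldNormedType.Exports.

Local Open Scope classical_set_scope.
Local Open Scope ring_scope.

(** * Quadratic forms, and nonnegativity of the form of [Gamma_of] *)

Lemma normsqE (R : realType) n (M : 'M[R]_n) (z : 'cV[R]_n) :
  normsq M z = \sum_i \sum_j M i j * (z i ord0 * z j ord0).
Proof.
rewrite /normsq mxE exchange_big; apply: eq_bigr => j _.
rewrite mxE mulr_suml; apply: eq_bigr => i _.
by rewrite mxE mulrAC mulrC.
Qed.

Lemma normsq_conj (R : realType) n (A M : 'M[R]_n) (z : 'cV[R]_n) :
  normsq (A^T *m M *m A) z = normsq M (A *m z).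
Proof. by rewrite /normsq trmx_mul !mulmxA. Qed.

Section PositiveDefinite.
Context {R : realType}.

Lemma pd_unitmx n (M : 'M[R]_n) : pd M -> M \in unitmx.
Proof.
case=> _ M0; rewrite -row_free_unit -kermx_eq0; apply/eqP/row_matrixP => i.
rewrite row0; apply: contraTeq isT => zN0.
have := M0 (row i (kermx M))^T; rewrite trmx_eq0 => /(_ zN0).
rewrite /normsq trmxK -row_mul mulmx_ker row0 mul0mx mxE.
by rewrite ltxx.
Qed.

Lemma invmx_normsq_ge0 n (M : 'M[R]_n) (v : 'cV[R]_n) :
  pd M -> 0 <= normsq (invmx M) v.
Proof.
move=> pdM; have uM := pd_unitmx pdM; have [symM M0] := pdM.
have -> : normsq (invmx M) v = normsq M (invmx M *m v).
  rewrite /normsq trmx_mul trmx_inv symM -!mulmxA.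
  by rewrite (mulmxA M) (mulmxV uM) mul1mx.
have [->|/M0/ltW//] := eqVneq (invmx M *m v) 0.
by rewrite /normsq mulmx0 mxE.
Qed.

Lemma Gamma_of_normsq_ge0 n m (A : 'M[R]_n) (B : 'M[R]_(n, m)) (Ru : 'M[R]_m)
    (gamma : R) (P : 'M[R]_n) (z : 'cV[R]_n) :
  0 <= gamma -> pd Ru -> psd P -> 0 <= normsq (Gamma_of A B Ru gamma P) z.
Proof.
move=> g0 [symR R0] [symP P0].
have pdRhat : pd (Rhat B Ru gamma P).
  split=> [|u uN0]; rewrite /Rhat.
    by rewrite linearD linearZ /= symR !trmx_mul trmxK symP mulmxA.
  rewrite /normsq mulmxDr mulmxDl -scalemxAr -scalemxAl mxE [X in _ + X]mxE.
  apply: ltr_wpDr; last exact: R0.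
  apply: mulr_ge0 => //; have := P0 (B *m u).
  by rewrite /normsq trmx_mul !mulmxA.
have -> : normsq (Gamma_of A B Ru gamma P) z =
    gamma ^+ 2 * normsq (invmx (Rhat B Ru gamma P)) (B^T *m P *m A *m z).
  rewrite /normsq /Gamma_of -scalemxAr -scalemxAl mxE.
  by rewrite !trmx_mul trmxK symP !mulmxA.
by rewrite mulr_ge0 ?exprn_ge0 ?invmx_normsq_ge0.
Qed.

End PositiveDefinite.

(** * Measurability of the controlled run *)

Section MeasurableColumn.
Context {d1 d2 : measure_display} {T1 : measurableType d1}
  {T2 : measurableType d2} {n : nat}.

Lemma measurable_cV_coord (i : 'I_n) :
  measurable_fun [set: 'cV[T2]_n] (fun z : 'cV[T2]_n => z i ord0).
Proof.
move=> _ Y mY; rewrite setTI; apply: sub_sigma_algebra.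
rewrite -bigcup_seq; exists i => /=; first by rewrite mem_index_enum.
by exists Y => //; rewrite setTI.
Qed.

Lemma measurable_fun_cV (f : T1 -> 'cV[T2]_n) :
  (forall i, measurable_fun [set: T1] (fun x => f x i ord0)) ->
  measurable_fun [set: T1] f.
Proof.
move=> mf; apply: measurability; first by [].
move=> _ [C + <-]; rewrite -bigcup_seq => -[i _ [Y mY <-]].
by rewrite !setTI; have := mf i measurableT Y mY; rewrite setTI.
Qed.

End MeasurableColumn.

Lemma measurable_normsq (R : realType) d (T : measurableType d) n
    (M : 'M[R]_n) (f : T -> 'cV[R]_n) :
  measurable_fun setT f -> measurable_fun setT (fun x => normsq M (f x)).
Proof.
move=> mf.
rewrite (_ : (fun _ => _) = fun x =>
  \sum_i \sum_j M i j * (f x i ord0 * f x j ord0)); last first.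
  by apply/funext => x; rewrite normsqE.
have mfi i : measurable_fun setT (fun x => f x i ord0).
  exact: (measurableT_comp (measurable_cV_coord i) mf).
apply: measurable_sum => i; apply: measurable_sum => j.
by apply: measurable_funM => //; exact: measurable_funM.
Qed.

Lemma measurable_transition (R : realType) d (T : measurableType d) n
    (A : 'M[R]_n) (f w : T -> 'cV[R]_n) (a : T -> bool) :
  measurable_fun setT f -> measurable_fun setT w -> measurable_fun setT a ->
  measurable_fun setT (fun x => transition A (f x) (a x) (w x)).
Proof.
move=> mf mw ma; apply: measurable_fun_cV => i.
have coordE g : measurable_fun setT g ->
    forall j, measurable_fun setT (fun x : T => (g x : 'cV[R]_n) j ord0).
  by move=> mg j; exact: (measurableT_comp (measurable_cV_coord j) mg).
(* As a case distinction on the action, each coordinate is either 0 or affine in the coordinates of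
   the state and the noise. *)
rewrite (_ : (fun _ => _) = fun x => if a x then 0 else
   \sum_j A i j * f x j ord0 + w x i ord0); last first.
  apply/funext => x; rewrite /transition !mxE.
  by case: (a x); rewrite ?subrr ?mul0r// subr0 mul1r.
apply: measurable_fun_ifT => //; apply: measurable_funD; last exact: coordE.
by apply: measurable_sum => j; apply: measurable_funM => //; exact: coordE.
Qed.

Section MeasurableRun.
Context {R : realType} {n : nat}.
Variables (A Gamma : 'M[R]_n) (lambda : R).
Context {d : measure_display} {T : measurableType d}.
Variables (mu : policy (R := R) (n := n)) (e : 'cV[R]_n) (a : bool).
Variable w : T -> nat -> 'cV[R]_n.
Hypothesis mw : forall j, measurable_fun setT (fun x => w x j).

Lemma measurable_run_current k :
  measurable_fun setT (fun x => run A mu e a (w x) k) ->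
  measurable_fun setT (fun x => current (run A mu e a (w x) k)).
Proof.
move=> mr; have : measurable_fun setT (fun x => (run A mu e a (w x) k).1).
  exact: measurableT_comp.
by move/measurable_fun_tnthP => /(_ ord0).
Qed.

Lemma measurable_run_action k :
  measurable_fun setT (fun x => run A mu e a (w x) k) ->
  measurable_fun setT (fun x => action mu a (run A mu e a (w x) k)).
Proof.
by case: k => [|k] mr; [exact: measurable_cst | exact: measurableT_comp].
Qed.

(** The domain [T] is arbitrary because this is applied both on [Omega] and on the space of finite
    noise tuples. *)
Lemma measurable_run k : measurable_fun setT (fun x => run A mu e a (w x) k).
Proof.
elim: k => [|k mr]; first exact: measurable_cst.
apply: measurable_fun_pair.
- apply: measurable_cons; last exact: measurableT_comp.
  apply: measurable_transition => //; first exact: measurable_run_current.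
  exact: measurable_run_action.
- apply: measurable_cons; last exact: measurableT_comp.
  exact: measurable_run_action.
Qed.

Lemma measurable_run_cost k :
  measurable_fun setT (fun x => run_cost A Gamma lambda mu e a (w x) k).
Proof.
apply: measurable_funD.
  by apply: measurable_normsq; apply/measurable_run_current/measurable_run.
apply: measurable_funM => //.
apply: (measurableT_comp (f := fun b : bool => b%:R : R)) => //.
exact/measurable_run_action/measurable_run.
Qed.

End MeasurableRun.

(** * Invariance of the law of i.i.d. noise under injective reindexing *)

Section IidShift.
Context {R : realType} {d d' : measure_display} {Omega : measurableType d}
  {T : measurableType d'}.
Variables (Pr : probability Omega R) (X : nat -> {RV Pr >-> T}).
Hypotheses (indepX : mutually_independent X) (idX : identically_distributed X).
Variable N : nat.

(** Measurable rectangles, the pi-system used for uniqueness of measures. The sides are indexed by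
    [nat] to match [mutually_independent]. *)
Definition cylinders : set (set (N.-tuple T)) :=
  [set C | exists2 S : nat -> set T, (forall k, measurable (S k)) &
    C = [set t | forall i : 'I_N, S i (tnth t i)]].

Lemma cylindersI : setI_closed cylinders.
Proof.
move=> _ _ [S mS ->] [S' mS' ->]; exists (fun k => S k `&` S' k) => [k|].
  exact: measurableI.
apply/seteqP; split => [t [tS tS'] i|t tSS']; first by split.
by split=> i; have [] := tSS' i.
Qed.

Lemma cylinders_measurable : cylinders `<=` measurable.
Proof.
move=> _ [S mS ->].
rewrite (_ : [set _ | _] =
  \bigcap_(i in [set: 'I_N]) ((@tnth _ T)^~ i @^-1` S i)); last first.
  by apply/seteqP; split => t tS i; [move=> _; exact: tS | exact: (tS i)].
apply: fin_bigcap_measurable; first exact: finite_finset.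
by move=> i _; rewrite -[X in measurable X]setTI; exact: measurable_tnth.
Qed.

Lemma measurable_cylinders : measurable = <<s cylinders >>.
Proof.
apply/seteqP; split; last first.
  exact: (smallest_sub (@sigma_algebra_measurable _ _) cylinders_measurable).
apply: smallest_sub; first exact: smallest_sigma_algebra.
move=> C; rewrite -bigcup_seq => -[i _ [Y mY <-]]; rewrite setTI.
apply: sub_sigma_algebra; exists (fun k => if k == i :> nat then Y else setT).
  by move=> k; case: ifP.
apply/seteqP; split => t /=; last by move=> /(_ i); rewrite eqxx.
by move=> tY j; case: ifPn => // /eqP/val_inj ->.
Qed.

Definition noise_tuple (f : nat -> nat) (x : Omega) : N.-tuple T :=
  [tuple X (f i) x | i < N].

Lemma measurable_noise_tuple f : measurable_fun setT (noise_tuple f).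
Proof.
apply/measurable_fun_tnthP => i.
rewrite (_ : _ \o _ = X (f i)) //.
by apply/funext => x /=; rewrite tnth_mktuple.
Qed.

HB.instance Definition _ f :=
  isMeasurableFun.Build _ _ _ _ (noise_tuple f) (measurable_noise_tuple f).

(** Independence over the image of [f] gives a product, and identical distribution replaces every
    factor by one of [X 0]; what results no longer mentions [f]. *)
Lemma iid_cylinderE (f : nat -> nat) (S : nat -> set T) : injective f ->
  (forall k, measurable (S k)) ->
  Pr (noise_tuple f @^-1` [set t | forall i : 'I_N, S i (tnth t i)]) =
  (\prod_(k <- [fset k in iota 0 N]%fset) Pr (X 0%N @^-1` S k))%E.
Proof.
move=> injf mS; set J := [fset k in iota 0 N]%fset.
(* A left inverse of [f], with default 0 off its range; it transports the sides [S] to the indices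
   [f k]. *)
pose g k := xget 0%N [set j | f j = k].
have gK j : g (f j) = j.
  by apply: injf; exact: (xgetPex 0%N (ex_intro (fun i => f i = f j) j erefl)).
have := indepX (f @` J)%fset (S := S \o g) (fun k => mS _).
rewrite big_imfset/=; last by move=> ? ? _ _; exact: injf.
under eq_bigr => k _ do rewrite gK
  -[Pr _]/(distribution Pr (X (f k)) (S k)) idX//.
move=> <-; congr (Pr _); apply/seteqP; split => x /=.
  move=> xS _ /= /imfsetP[k /= + ->]; rewrite inE /= mem_iota /= gK => kN.
  by have := xS (Ordinal kN); rewrite tnth_mktuple.
move=> xS i; rewrite tnth_mktuple; have := xS (f i); rewrite /= gK; apply.
by apply/imfsetP; exists (i : nat) => //; rewrite inE /= mem_iota /=.
Qed.

(** Both laws are finite and agree on the generating pi-system of rectangles. *)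
Lemma iid_reindex_law (f g : nat -> nat) (C : set (N.-tuple T)) :
  injective f -> injective g -> measurable C ->
  distribution Pr (noise_tuple f) C = distribution Pr (noise_tuple g) C.
Proof.
move=> injf injg.
apply: (measure_unique cylinders (fun=> setT) measurable_cylinders
  cylindersI _ _ (distribution Pr (noise_tuple f))
  (distribution Pr (noise_tuple g))).
- by move=> _; exists (fun=> setT) => //; apply/seteqP; split.
- by apply/seteqP; split => // x _; exists 0%N.
- move=> _ [S mS ->].
  transitivity (\prod_(k <- [fset k in iota 0 N]%fset) Pr (X 0%N @^-1` S k))%E.
    exact: iid_cylinderE.
  exact/esym/iid_cylinderE.
- by move=> _; exact: (le_lt_trans (probability_le1 _ measurableT) (ltry _)).
Qed.

Lemma iid_reindex_integral (f g : nat -> nat) (F : N.-tuple T -> \bar R) :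
  injective f -> injective g ->
  measurable_fun setT F -> (forall t, 0 <= F t)%E ->
  (\int[Pr]_x F (noise_tuple f x) = \int[Pr]_x F (noise_tuple g x))%E.
Proof.
move=> injf injg mF F0.
have pushE h : (\int[Pr]_x F (noise_tuple h x) =
    \int[distribution Pr (noise_tuple h)]_t F t)%E.
  by rewrite (ge0_integral_pushforward (measurable_noise_tuple h) Pr
    measurableT mF (fun t _ => F0 t)).
rewrite (pushE f) (pushE g).
apply: (eq_measure_integral (distribution Pr (noise_tuple g))) => C mC _.
exact: iid_reindex_law.
Qed.

End IidShift.

(** * Expectation of a quadratic form of a shifted random vector *)

Section QuadraticExpectation.
Context {R : realType} {d : measure_display} {Omega : measurableType d}.
Variable Pr : probability Omega R.

(** Integrability travels with the value, since additivity and scaling of the expectation require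
    it. *)
Definition has_mean (f : Omega -> R) (c : R) :=
  f \in Lfun Pr 1 /\ ('E_Pr[f] = c%:E)%E.

Lemma has_mean_cst c : has_mean (cst c) c.
Proof. by split; [exact: Lfun_cst | rewrite expectation_cst]. Qed.

Lemma has_meanD f g a b :
  has_mean f a -> has_mean g b -> has_mean (fun x => f x + g x) (a + b).
Proof.
move=> [lf Ef] [lg Eg]; split; first exact: (rpredD lf lg).
by rewrite (expectationD lf lg) Ef Eg.
Qed.

Lemma has_meanZ k f a : has_mean f a -> has_mean (fun x => k * f x) (k * a).
Proof.
move=> [lf Ef].
rewrite (_ : (fun _ => _) = k \o* f); last by apply/funext => x; rewrite /= mulrC.
by split; [exact: Lfun_scale | rewrite expectationZl// Ef].
Qed.

Lemma has_mean_sum (I : finType) (f : I -> Omega -> R) (c : I -> R) :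
  (forall i, has_mean (f i) (c i)) ->
  has_mean (fun x => \sum_i f i x) (\sum_i c i).
Proof.
move=> fc; elim: (index_enum I) => [|i s IH].
  by rewrite big_nil; under eq_fun do rewrite big_nil; exact: has_mean_cst.
by rewrite big_cons; under eq_fun do rewrite big_cons; exact: has_meanD.
Qed.

(* The linear terms of the expansion of [normsq M (v + X x)] have mean zero. *)
Lemma expectation_normsq n (M : 'M[R]_n) (X : Omega -> 'cV[R]_n) (v : 'cV[R]_n) :
  zero_mean Pr X -> finite_covariance Pr X ->
  has_mean (fun x => normsq M (v + X x))
    (normsq M v + \tr (M *m covariance_mx Pr X)).
Proof.
move=> mean0 cov.
have Xi i : has_mean (Defs.coord X i) 0 by have [] := mean0 i.
have Xij i j : has_mean (fun x => Defs.coord X i x * Defs.coord X j x)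
    (covariance_mx Pr X i j).
  have lij := Lfun2_mul_Lfun1 (cov i) (cov j).
  have [li Ei] := Xi i; have [lj Ej] := Xi j.
  split=> //; rewrite mxE covarianceE// Ei Ej mule0 sube0 fineK//.
  exact: expectation_fin_num.
(* The products with 0 are the means of the linear terms; keeping them gives this sum the shape of
   the random expansion below. *)
have -> : normsq M v + \tr (M *m covariance_mx Pr X) =
    \sum_i \sum_j M i j * (v i 0 * v j 0 + v i 0 * 0 + v j 0 * 0 +
      covariance_mx Pr X i j).
  rewrite normsqE /mxtrace -big_split; apply: eq_bigr => i _ /=.
  rewrite mxE -big_split; apply: eq_bigr => j _ /=.
  rewrite !mulr0 !addr0 mulrDr; congr (_ + _ * _).
  by rewrite !mxE covarianceC.
rewrite (_ : (fun _ => _) = fun x => \sum_i \sum_j M i j *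
    (v i 0 * v j 0 + v i 0 * Defs.coord X j x + v j 0 * Defs.coord X i x +
      Defs.coord X i x * Defs.coord X j x)); last first.
  apply/funext => x; rewrite normsqE; apply: eq_bigr => i _.
  by apply: eq_bigr => j _; rewrite /Defs.coord !mxE; congr (_ * _); ring.
apply: has_mean_sum => i; apply: has_mean_sum => j; apply: has_meanZ.
apply: has_meanD (Xij i j); apply: has_meanD; last exact: has_meanZ.
by apply: has_meanD; [exact: has_mean_cst | exact: has_meanZ].
Qed.

End QuadraticExpectation.

(** * The delayed policy and its run *)

Section DelayedPolicy.
Context {R : realType} {n : nat}.

(* Forgets the state [e_1] and the action [a_0]; both components of a history
   list the most recent item first. *)
Definition forget_second k (h : history (R := R) (n := n) k.+1) : history k :=
  ([tuple tnth h.1 (lift (inord k) i) | i < k.+1],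
   [tuple tnth h.2 (widen_ord (leqnSn k) i) | i < k]).

Lemma measurable_forget_second k : measurable_fun setT (@forget_second k).
Proof.
apply: measurable_fun_pair; apply/measurable_fun_tnthP => i.
- rewrite (_ : _ \o _ = (@tnth _ _)^~ (lift (inord k) i) \o fst).
    exact: (measurableT_comp (measurable_tnth _)).
  by apply/funext => h /=; rewrite tnth_mktuple.
- rewrite (_ : _ \o _ = (@tnth _ _)^~ (widen_ord (leqnSn k) i) \o snd).
    exact: (measurableT_comp (measurable_tnth _)).
  by apply/funext => h /=; rewrite tnth_mktuple.
Qed.

HB.instance Definition _ k := isMeasurableFun.Build _ _ _ _
  (@forget_second k) (@measurable_forget_second k).

(** Scheduling at time 1 makes the state 0 at time 2. Without [e_1] and [a_0], the history then
    looks like one in which the communication took place at time 0 from the same initial state, and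
    that is what [mu] is given. *)
Definition delayed_policy (mu : policy (R := R) (n := n)) : policy :=
  fun k => match k with
  | 0 | 1 => cst true
  | j.+2 => mu j.+1 \o @forget_second j.+1
  end.

Definition always_schedule : policy (R := R) (n := n) := fun k => cst true.

Variables (A Gamma : 'M[R]_n) (lambda : R).

Lemma transition_true (e w : 'cV[R]_n) : transition A e true w = 0.
Proof. by rewrite /transition subrr scale0r. Qed.

Lemma transition_false (e w : 'cV[R]_n) : transition A e false w = A *m e + w.
Proof. by rewrite /transition subr0 scale1r. Qed.

Lemma normsq0 (M : 'M[R]_n) : normsq M 0 = 0.
Proof. by rewrite /normsq mulmx0 mxE. Qed.

(** Causality: the cost at time [k] is a function of the first [k] noises, so comparing laws of
    finite tuples is enough. *)
Lemma eq_run mu e a (w w' : nat -> 'cV[R]_n) k :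
  (forall j, (j < k)%N -> w j = w' j) -> run A mu e a w k = run A mu e a w' k.
Proof.
elim: k => //= k IH ww'; rewrite (IH _) ?ww'// => j jk.
by rewrite ww'// ltnS ltnW.
Qed.

Lemma forget_second_cons k (x : 'cV[R]_n) (b : bool)
    (h : history (R := R) (n := n) k.+1) :
  forget_second (([tuple of x :: h.1], [tuple of b :: h.2]) : history k.+2) =
  ([tuple of x :: (forget_second h).1], [tuple of b :: (forget_second h).2]).
Proof.
congr pair; apply: eq_from_tnth => i; rewrite tnth_mktuple.
- case: (unliftP ord0 i) => [j|] ->; last first.
    rewrite (_ : lift _ _ = ord0) ?tnth0//.
    by apply/val_inj; rewrite /= /bump inordK.
  rewrite [RHS]tnthS tnth_mktuple.
  rewrite (_ : lift _ _ = lift ord0 (lift (inord k) j)) ?tnthS//.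
  by apply/val_inj; rewrite /= /bump !inordK// !add1n ltnS addnS.
- case: (unliftP ord0 i) => [j|] ->; last first.
    by rewrite (_ : widen_ord _ _ = ord0) ?tnth0//; apply/val_inj.
  rewrite [RHS]tnthS tnth_mktuple.
  by rewrite (_ : widen_ord _ _ = lift ord0 (widen_ord (leqnSn k) j)) ?tnthS//;
    apply/val_inj.
Qed.

(** From time 2 on, the deleted state [e_1] is no longer the newest one. *)
Lemma current_forget_second k (h : history (R := R) (n := n) k.+2) :
  current (forget_second h) = current h.
Proof.
rewrite /current /thead tnth_mktuple; congr tnth.
by apply/val_inj; rewrite /= /bump inordK.
Qed.

(** Two steps of the delayed run match one step of [mu]: the noise [w 0] enters only the deleted
    [e_1], and [w 1] is wiped out by the reset on both sides. *)
Lemma run_delayed_policy mu e (w : nat -> 'cV[R]_n) k :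
  forget_second (run A (delayed_policy mu) e false w k.+2) =
  run A mu e true (w \o succn) k.+1.
Proof.
elim: k => [|k IH].
  congr pair; apply: eq_from_tnth => i; rewrite tnth_mktuple.
  - case: (unliftP ord0 i) => [j|] ->; last first.
      rewrite (_ : lift _ _ = ord0) ?tnth0 ?transition_true//.
      by apply/val_inj; rewrite /= /bump inordK.
    rewrite !ord1 (_ : lift _ _ = lift ord0 (lift ord0 ord0)) ?tnthS//.
    by apply/val_inj; rewrite /= /bump inordK.
  - by rewrite !ord1 (_ : widen_ord _ _ = ord0)//; apply/val_inj.
rewrite [LHS]forget_second_cons IH [RHS]/=.
by rewrite -[action _ _ _]/(mu k.+1 (forget_second _)) -current_forget_second IH.
Qed.

Lemma run_cost_delayed_policy mu e (w : nat -> 'cV[R]_n) k :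
  run_cost A Gamma lambda (delayed_policy mu) e false w k.+2 =
  run_cost A Gamma lambda mu e true (w \o succn) k.+1.
Proof.
rewrite /run_cost -current_forget_second run_delayed_policy.
by rewrite -[action _ _ _]/(mu k.+1 (forget_second _)) run_delayed_policy.
Qed.

Lemma run_cost0 mu e a (w : nat -> 'cV[R]_n) :
  run_cost A Gamma lambda mu e a w 0 = normsq Gamma e + lambda * a%:R.
Proof. by []. Qed.

Lemma run_cost1_false mu e (w : nat -> 'cV[R]_n) :
  run_cost A Gamma lambda mu e false w 1 =
  normsq Gamma (A *m e + w 0%N) +
  lambda * (mu 1 (run A mu e false w 1))%:R.
Proof.
rewrite /run_cost /stage_cost; congr (normsq _ _ + _).
exact: transition_false.
Qed.

Lemma run_cost_always_schedule e (w : nat -> 'cV[R]_n) k :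
  run_cost A Gamma lambda always_schedule e true w k.+1 = lambda.
Proof.
rewrite /run_cost /stage_cost (_ : current _ = 0) ?normsq0 ?add0r ?mulr1//.
(* The action producing this state is the prescribed one at time 0 and the policy's one afterwards;
   both are [true]. *)
by case: k => [|k]; exact: transition_true.
Qed.

End DelayedPolicy.

Lemma nneseries_recl_shift (R : realType) (f : nat -> \bar R) :
  (forall k, 0 <= f k)%E ->
  (\sum_(0 <= k <oo) f k = f 0%N + \sum_(0 <= k <oo) f k.+1)%E.
Proof.
move=> f0; rewrite nneseries_recl// -(nneseries_addn 1)//.
by congr (_ + _)%E; apply: eq_eseriesr => k _; rewrite addn1.
Qed.

(** * Decomposition of the policy value into expected stage costs *)

Section Scheduling.
Context {R : realType} {n : nat} {d : measure_display}
  {Omega : measurableType d}.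
Variables (A Gamma : 'M[R]_n) (lambda gamma : R).
Variables (Pr : probability Omega R) (W : nat -> {RV Pr >-> 'cV[R]_n}).
Hypotheses (Gamma_ge0 : forall z, 0 <= normsq Gamma z)
  (gamma_gt0 : 0 < gamma) (gamma_lt1 : gamma < 1) (lambda_gt0 : 0 < lambda).

Definition noise (omega : Omega) (j : nat) : 'cV[R]_n := W j omega.

Definition expected_cost mu e a k : \bar R :=
  (\int[Pr]_omega
    (gamma ^+ k * run_cost A Gamma lambda mu e a (noise omega) k)%:E)%E.

Lemma run_cost_ge0 mu e a w k : 0 <= run_cost A Gamma lambda mu e a w k.
Proof. by rewrite addr_ge0// mulr_ge0// ltW. Qed.

Lemma discounted_cost_ge0 mu e a w k :
  (0 <= (gamma ^+ k * run_cost A Gamma lambda mu e a w k)%:E)%E.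
Proof. by rewrite lee_fin mulr_ge0 ?run_cost_ge0// exprn_ge0// ltW. Qed.

Lemma measurable_discounted_cost mu e a k : measurable_fun setT
  (fun omega => (gamma ^+ k * run_cost A Gamma lambda mu e a (noise omega) k)%:E).
Proof.
apply/measurable_EFinP/measurable_funM => //.
by apply: measurable_run_cost => j; exact: measurable_funP.
Qed.

Lemma expected_cost_ge0 mu e a k : (0 <= expected_cost mu e a k)%E.
Proof. by apply: integral_ge0 => omega _; exact: discounted_cost_ge0. Qed.

Lemma QpolicyE mu e a : Qpolicy A Gamma lambda gamma W mu e a =
  (\sum_(0 <= k <oo) expected_cost mu e a k)%E.
Proof.
rewrite /Qpolicy integral_nneseries// => k.
- exact: measurable_discounted_cost.
- by move=> omega _; exact: discounted_cost_ge0.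
Qed.

Lemma Qpolicy_ge0 mu e a : (0 <= Qpolicy A Gamma lambda gamma W mu e a)%E.
Proof. by rewrite QpolicyE nneseries_ge0// => k _ _; exact: expected_cost_ge0. Qed.

Lemma expected_cost0 mu e a :
  expected_cost mu e a 0 = (normsq Gamma e + lambda * a%:R)%:E.
Proof.
rewrite /expected_cost; under eq_integral do rewrite run_cost0 expr0 mul1r.
by rewrite integral_cst//= probability_setT mule1.
Qed.

Lemma Qpolicy_recl mu e a : Qpolicy A Gamma lambda gamma W mu e a =
  ((normsq Gamma e + lambda * a%:R)%:E +
   \sum_(0 <= k <oo) expected_cost mu e a k.+1)%E.
Proof.
by rewrite QpolicyE (nneseries_recl_shift (expected_cost_ge0 mu e a))
  expected_cost0.
Qed.

Lemma Qpolicy_recl2 mu e a : Qpolicy A Gamma lambda gamma W mu e a =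
  ((normsq Gamma e + lambda * a%:R)%:E + (expected_cost mu e a 1 +
   \sum_(0 <= k <oo) expected_cost mu e a k.+2))%E.
Proof.
by rewrite Qpolicy_recl
  (nneseries_recl_shift (fun k => expected_cost_ge0 mu e a k.+1)).
Qed.

Lemma Qpolicy_always_schedule_le e :
  (Qpolicy A Gamma lambda gamma W always_schedule e true <=
   (normsq Gamma e + lambda / (1 - gamma))%:E)%E.
Proof.
have gamma1 : 0 < 1 - gamma by rewrite subr_gt0.
rewrite Qpolicy_recl mulr1.
have -> : lambda / (1 - gamma) = lambda + gamma * lambda / (1 - gamma).
  by field; rewrite gt_eqF.
rewrite addrA [leRHS]EFinD leeD2l//.
have costE k : expected_cost always_schedule e true k.+1 =
    (gamma ^+ k.+1 * lambda)%:E.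
  rewrite /expected_cost.
  under eq_integral do rewrite run_cost_always_schedule.
  by rewrite integral_cst//= probability_setT mule1.
rewrite (eq_eseriesr (fun k _ => costE k)).
apply: lime_le.
  by apply: is_cvg_nneseries => k _ _; rewrite lee_fin mulr_ge0 ?exprn_ge0 ?ltW.
apply: nearW => N; rewrite sumEFin lee_fin.
(* The geometric partial sum in closed form; the factor [1 - gamma ^+ N] is at most 1. *)
have -> : \sum_(0 <= k < N) gamma ^+ k.+1 * lambda =
    gamma * lambda / (1 - gamma) * (1 - gamma ^+ N).
  elim: N => [|N IH]; first by rewrite big_geq// expr0 subrr mulr0.
  by rewrite big_nat_recr//= IH !exprS; field; rewrite gt_eqF.
rewrite ler_piMr//; first by rewrite divr_ge0 ?mulr_ge0 ?ltW.
by rewrite lerBlDr lerDl exprn_ge0 ?ltW.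
Qed.

(** * Comparison of policies under i.i.d. noise *)

Section IidNoise.
Hypotheses (indepW : mutually_independent W) (idW : identically_distributed W)
  (W_mean : zero_mean Pr (W 0%N)) (W_cov : finite_covariance Pr (W 0%N)).

Let KW := covariance_mx Pr (W 0%N).

Lemma expected_run_cost_shift mu e a k :
  (\int[Pr]_omega
     (gamma ^+ k * run_cost A Gamma lambda mu e a (noise omega \o succn) k)%:E =
   expected_cost mu e a k)%E.
Proof.
(* The tuple is extended by 0 to a noise sequence; by causality the values from index [k] on never
   reach the cost at time [k]. *)
pose F (t : k.-tuple 'cV[R]_n) :=
  (gamma ^+ k * run_cost A Gamma lambda mu e a (nth 0 t) k)%:E.
have FE (f : nat -> nat) omega : F (noise_tuple W k f omega) =
    (gamma ^+ k * run_cost A Gamma lambda mu e a (noise omega \o f) k)%:E.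
  rewrite /F /run_cost (@eq_run _ _ _ _ _ _ _ (noise omega \o f))// => j jk.
  by rewrite -[j in LHS]/(nat_of_ord (Ordinal jk)) -tnth_nth tnth_mktuple.
have F0 t : (0 <= F t)%E by exact: discounted_cost_ge0.
have mF : measurable_fun setT F.
  apply/measurable_EFinP/measurable_funM; first exact: measurable_cst.
  apply: measurable_run_cost => j.
  have [jk|kj] := ltnP j k.
    rewrite (_ : (fun _ => _) = (@tnth _ _)^~ (Ordinal jk)).
      exact: measurable_tnth.
    by apply/funext => t; rewrite (tnth_nth 0).
  rewrite (_ : (fun _ => _) = cst 0); first exact: measurable_cst.
  by apply/funext => t; rewrite nth_default// size_tuple.
transitivity (\int[Pr]_omega F (noise_tuple W k succn omega))%E.
  by apply: eq_integral => omega _; rewrite FE.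
rewrite (iid_reindex_integral indepW idW succn_inj (@inj_id nat) mF F0).
by apply: eq_integral => omega _; rewrite FE.
Qed.

Lemma integral_normsq v (c : R) :
  (\int[Pr]_omega (gamma * (normsq Gamma (v + W 0%N omega) + c))%:E =
   (gamma * (normsq Gamma v + \tr (Gamma *m KW) + c))%:E)%E.
Proof.
have [_] := has_meanZ gamma
  (has_meanD (expectation_normsq Gamma v W_mean W_cov) (has_mean_cst Pr c)).
by rewrite unlock.
Qed.

(** Whatever is chosen at time 1, the state is already [A e + W 0]; only the nonnegative
    communication cost is dropped. *)
Lemma expected_cost1_ge mu e :
  ((gamma * (normsq (A^T *m Gamma *m A) e + \tr (Gamma *m KW)))%:E <=
   expected_cost mu e false 1)%E.
Proof.
rewrite normsq_conj -[in leLHS](addr0 (_ + _)) -integral_normsq.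
apply: ge0_le_integral => //.
- by move=> omega _; rewrite lee_fin addr0 mulr_ge0// ltW.
- apply/measurable_EFinP/measurable_funM => //; apply: measurable_funD => //.
  apply: measurable_normsq.
  pose w omega := transition A e false (W 0%N omega).
  rewrite (_ : (fun _ => _) = w).
    by apply: measurable_transition => //; exact: measurable_funP.
  by apply/funext => omega; rewrite /w transition_false.
- exact: measurable_discounted_cost.
- move=> omega _; rewrite lee_fin run_cost1_false expr1 ler_pM2l//.
  by rewrite lerD2l mulr_ge0// ltW.
Qed.

Lemma expected_cost1_delayed mu e :
  expected_cost (delayed_policy mu) e false 1 =
  (gamma * (normsq (A^T *m Gamma *m A) e + \tr (Gamma *m KW) + lambda))%:E.
Proof.
rewrite normsq_conj -integral_normsq; apply: eq_integral => omega _.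
by rewrite run_cost1_false expr1 /= mulr1.
Qed.

(** Pathwise these are the costs of [mu] under the noise shifted by one; the shift leaves the
    expectation unchanged and the delay costs one factor [gamma]. *)
Lemma expected_cost_delayed mu e k :
  expected_cost (delayed_policy mu) e false k.+2 =
  (gamma%:E * expected_cost mu e true k.+1)%E.
Proof.
rewrite -[in RHS]expected_run_cost_shift -ge0_integralZl//; last 3 first.
- apply/measurable_EFinP/measurable_funM => //.
  apply: measurable_run_cost => j.
  exact: measurable_funP.
- by move=> omega _; exact: discounted_cost_ge0.
- by rewrite lee_fin ltW.
apply: eq_integral => omega _.
by rewrite run_cost_delayed_policy -EFinM mulrA -exprS.
Qed.

Lemma Qpolicy_delayed_le mu e :
  (Qpolicy A Gamma lambda gamma W (delayed_policy mu) e false +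
   (lambda - gamma *
     (normsq (A^T *m Gamma *m A) e + \tr (Gamma *m KW) + lambda))%:E <=
   Qpolicy A Gamma lambda gamma W mu e true)%E.
Proof.
rewrite Qpolicy_recl2 Qpolicy_recl expected_cost1_delayed mulr0 addr0 mulr1.
rewrite (eq_eseriesr (fun k _ => expected_cost_delayed mu e k)).
rewrite nneseriesZl; last by move=> k _; exact: expected_cost_ge0.
set x := \big[_/_]_(_ <= _ <oo) _; set c := gamma * _.
have x0 : (0 <= x)%E by apply: nneseries_ge0 => k _ _; exact: expected_cost_ge0.
(* The common tail [x] of the costs may be infinite, and then the right side is [+oo]; a finite
   nonnegative tail satisfies [gamma * x <= x]. *)
move: x x0 => [x x0|_|//]; last by rewrite [leRHS]addey// leey.
rewrite -EFinM -!EFinD lee_fin; move: x0; rewrite lee_fin => x0.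
have : gamma * x <= x by rewrite ler_piMl// ltW.
lra.
Qed.

Lemma Qopt_true_lty e : (Qopt A Gamma lambda gamma W e true < +oo)%E.
Proof.
apply: le_lt_trans (ltry (normsq Gamma e + lambda / (1 - gamma))).
apply: le_trans (Qpolicy_always_schedule_le e).
by apply: ereal_inf_lbound; exists always_schedule.
Qed.

Lemma Qopt_false_lt_true e :
  normsq (A^T *m Gamma *m A) e < lambda * (gamma^-1 - 1) - \tr (Gamma *m KW) ->
  (Qopt A Gamma lambda gamma W e false < Qopt A Gamma lambda gamma W e true)%E.
Proof.
move=> small.
set delta := lambda - gamma *
  (normsq (A^T *m Gamma *m A) e + \tr (Gamma *m KW) + lambda).
have delta0 : 0 < delta.
  (* Positivity of [delta] is the hypothesis multiplied by [gamma]. *)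
  rewrite subr_gt0 -ltr_pdivlMl// mulrC; lra.
have gap : (Qopt A Gamma lambda gamma W e false + delta%:E <=
    Qopt A Gamma lambda gamma W e true)%E.
  apply/ereal_infP => _ [mu _ <-]; apply: le_trans (Qpolicy_delayed_le mu e).
  by apply: leeD => //; apply: ereal_inf_lbound; exists (delayed_policy mu).
(* Adding [delta] is a strict increase only at a finite value; finiteness comes from [gap] and the
   finite cost of always scheduling. *)
apply: (lt_le_trans _ gap); rewrite lteDl ?lte_fin// ge0_fin_numE; last first.
  by apply/ereal_infP => _ [mu _ <-]; exact: Qpolicy_ge0.
apply: le_lt_trans (Qopt_true_lty e); apply: le_trans gap.
by rewrite leeDl// lee_fin ltW.
Qed.

Lemma Qopt_true_lt_false e :
  normsq (A^T *m Gamma *m A) e >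
    lambda / (gamma * (1 - gamma)) - \tr (Gamma *m KW) ->
  (Qopt A Gamma lambda gamma W e true < Qopt A Gamma lambda gamma W e false)%E.
Proof.
move=> large.
apply: (@le_lt_trans _ _ (normsq Gamma e + lambda / (1 - gamma))%:E).
  apply: le_trans (Qpolicy_always_schedule_le e).
  by apply: ereal_inf_lbound; exists always_schedule.
(* The intermediate value bounds the first two stage costs from below; dividing by [gamma] turns the
   strict inequality into the hypothesis. *)
apply: (@lt_le_trans _ _ (normsq Gamma e + gamma *
  (normsq (A^T *m Gamma *m A) e + \tr (Gamma *m KW)))%:E).
  rewrite lte_fin ltrD2l -ltr_pdivrMl//.
  rewrite (_ : gamma^-1 * _ = lambda / (gamma * (1 - gamma))) -?ltrBlDr//.
  by field; rewrite !gt_eqF// subr_gt0.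
apply/ereal_infP => _ [mu _ <-].
rewrite Qpolicy_recl2 mulr0 addr0 EFinD leeD2l//.
apply: le_trans (expected_cost1_ge mu e) _; rewrite leeDl// nneseries_ge0// => k _ _.
exact: expected_cost_ge0.
Qed.

End IidNoise.
End Scheduling.

(** * From strict inequalities to the set of minimizers *)

Lemma argmin_bool (R : realType) (f : bool -> \bar R) b :
  (f b < f (~~ b))%E -> argmin f = [set b].
Proof.
move=> fb; apply/seteqP; split => [x fx /=|_ -> y].
  apply/eqP; apply: contraLR fb => xb; rewrite -leNgt.
  by move: (fx b); case: (x) (b) xb => [] [].
by case: (y) (b) fb => [] [] // /ltW.
Qed.

Theorem mainTheorem2 (R : realType) (nx nu : nat)
    (A : 'M[R]_nx) (B : 'M[R]_(nx, nu)) (Q0 sqrtQ0 : 'M[R]_nx) (Ru : 'M[R]_nu)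
    (gamma lambda : R)
    (hQ0 : psd Q0) (hRu : pd Ru)
    (hgamma : 0 < gamma < 1) (hlambda : 0 < lambda)
    (hAB : controllable A B)
    (hsqrt : is_psd_sqrt sqrtQ0 Q0) (hAQ : observable A sqrtQ0)
    (P : 'M[R]_nx) (hP : psd P) (hPeq : riccati A B Ru gamma Q0 P)
    (d : measure_display) (Omega : measurableType d) (Pr : probability Omega R)
    (W : nat -> {RV Pr >-> 'cV[R]_nx})
    (hWindep : mutually_independent W) (hWid : identically_distributed W)
    (hWmean : zero_mean Pr (W 0%N)) (hWcov : finite_covariance Pr (W 0%N))
    (e : 'cV[R]_nx) :
  let Gamma := Gamma_of A B Ru gamma P in
  let KW := covariance_mx Pr (W 0%N) in
  let Q := Qopt A Gamma lambda gamma W in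
  (normsq (A^T *m Gamma *m A) e < lambda * (gamma^-1 - 1) - \tr (Gamma *m KW) ->
     argmin (Q e) = [set false]) /\
  (normsq (A^T *m Gamma *m A) e > lambda / (gamma * (1 - gamma)) - \tr (Gamma *m KW) ->
     argmin (Q e) = [set true]).
Proof.
move=> Gamma KW Q; have /andP[gamma0 gamma1] := hgamma.
have Gamma0 z : 0 <= normsq Gamma z by apply: Gamma_of_normsq_ge0 => //; exact: ltW.
by split=> He; apply: argmin_bool;
  [exact: Qopt_false_lt_true | exact: Qopt_true_lt_false].
Qed.
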